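(* The matrix $$A_\star=\begin{pmatrix}100&106&-18&-81\\92&158&-24&-101\\2&44&37&-7\\21&38&0&2\end{pmatrix}$$ has $23$ distinct regular Pareto eigenvalues. In particular, $c_4^{\mathrm{reg}}\ge 23$ and $c_4\ge 23$.
   Context: For $A\in\mathbb{R}^{n\times n}$, a real number $\lambda$ is a Pareto eigenvalue of $A$ if there exists $x\in\mathbb{R}^n\setminus\{0\}$ with $x\ge 0$, $Ax-\lambda x\ge 0$ (componentwise) and $\langle x,Ax-\lambda x\rangle=0$; $\Pi(A)$ is the set of Pareto eigenvalues of $A$ and $c_n:=\max_{A\in\mathbb{R}^{n\times n}}|\Pi(A)|$. For a nonempty $J\subseteq\{1,\dots,n\}$, $A_J$ is the principal submatrix indexed by $J$, $J^{\mathrm c}$ is the complement of $J$ in $\{1,\dots,n\}$, and $A_{J^{\mathrm c},J}$ is the block with rows in $J^{\mathrm c}$ and columns in $J$. The support $J$ regularly produces $\lambda\in\mathbb{R}$ if $\lambda$ is an algebraically simple eigenvalue of $A_J$ and there is $u\in\mathbb{R}^{J}$ with all entries $>0$ such that $A_Ju=\lambda u$ and $A_{J^{\mathrm c},J}u>0$ componentwise (the last condition being empty if $J=\{1,\dots,n\}$). $\Pi^{\mathrm{reg}}(A)$ is the set of values $\lambda$ regularly produced by at least one nonempty $J$ (its elements are called regular Pareto eigenvalues of $A$), and $c_n^{\mathrm{reg}}:=\max_{A\in\mathbb{R}^{n\times n}}|\Pi^{\mathrm{reg}}(A)|$. *)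

(* Defs.v *)
From HB Require Import structures.
From mathcomp Require Import all_boot all_order all_algebra.
From mathcomp Require Import all_classical reals.

Set Implicit Arguments.
Unset Strict Implicit.
Unset Printing Implicit Defensive.

Import Order.TTheory GRing.Theory Num.Theory.
Local Open Scope classical_set_scope.
Local Open Scope card_scope.
Local Open Scope ring_scope.

Definition pareto_eigenvalue (R : realType) (n : nat) (A : 'M[R]_n)
    (lambda : R) : Prop :=
  exists x : 'cV[R]_n,
    [/\ x != 0,
        (forall i, 0 <= x i 0),
        (forall i, 0 <= (A *m x - lambda *: x) i 0) &
        \sum_i x i 0 * (A *m x - lambda *: x) i 0 = 0].

Definition pareto_spectrum (R : realType) (n : nat) (A : 'M[R]_n) : set R :=
  [set lambda | pareto_eigenvalue A lambda].

(* Rows in I and columns in J, both listed in increasing order. *)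
Definition subblock (R : realType) (n : nat) (A : 'M[R]_n)
    (I J : {set 'I_n}) : 'M[R]_(#|I|, #|J|) :=
  \matrix_(i < #|I|, j < #|J|) A (enum_val i) (enum_val j).

Definition principal_submx (R : realType) (n : nat) (A : 'M[R]_n)
    (J : {set 'I_n}) : 'M[R]_#|J| := subblock A J J.

Definition simple_eigenvalue (R : realType) (k : nat) (B : 'M[R]_k)
    (lambda : R) : Prop :=
  mup lambda (char_poly B) = 1%N.

Definition regularly_produces (R : realType) (n : nat) (A : 'M[R]_n)
    (J : {set 'I_n}) (lambda : R) : Prop :=
  simple_eigenvalue (principal_submx A J) lambda /\
  exists u : 'cV[R]_#|J|,
    [/\ (forall j, 0 < u j 0),
        principal_submx A J *m u = lambda *: u &
        (forall i, 0 < (subblock A (finset.setC J) J *m u) i 0)].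

Definition regular_pareto_spectrum (R : realType) (n : nat) (A : 'M[R]_n) :
    set R :=
  [set lambda | exists J : {set 'I_n},
     J != finset.set0 /\ regularly_produces A J lambda].

Definition is_max_card (R : realType) (n : nat) (F : 'M[R]_n -> set R)
    (m : nat) : Prop :=
  (exists A : 'M[R]_n, F A #= `I_m) /\ (forall A : 'M[R]_n, F A #<= `I_m).

(* The maximum of |F A| over all A. The default value 0 is returned only when
   there is no maximum; for the two spectra above it always exists, since
   |F A| is at most the number of eigenvalues of all principal submatrices,
   hence at most n * 2 ^ (n - 1). *)
Definition max_card (R : realType) (n : nat) (F : 'M[R]_n -> set R) : nat :=
  xget 0%N [set m | is_max_card F m].

Definition pareto_max (R : realType) (n : nat) : nat :=
  max_card (@pareto_spectrum R n).

Definition pareto_max_reg (R : realType) (n : nat) : nat :=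
  max_card (@regular_pareto_spectrum R n).

Definition A_star (R : realType) : 'M[R]_4 :=
  \matrix_(i < 4, j < 4)
    (nth [::] [:: [:: 100; 106; - 18; - 81];
                  [::  92; 158; - 24; - 101];
                  [::   2;  44;   37; - 7];
                  [::  21;  38;    0; 2]] i)`_j.

(* Main.v *)
(* Every principal submatrix of A_star of order k has k distinct real
   eigenvalues, isolated by sign changes of its characteristic polynomial p. At a
   root x of p, a column of adj (x - A_J) is an eigenvector whose entries are
   polynomials in x, so its sign pattern is decided by interval evaluation. This
   gives 23 regular eigenvalues in pairwise disjoint intervals; each of the 9
   other pairs (J, x) is excluded by a Farkas vector that works on a whole
   interval around x. Since there are k eigenvalues for k slots, all of them are
   simple and no other eigenvalue of A_J exists. The maxima exist because Pareto
   eigenvalues are roots of the product of the characteristic polynomials of all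
   principal submatrices. *)
From Stdlib Require Import ZArith.
From HB Require Import structures.
Require Import Defs.
From mathcomp Require Import all_boot all_order all_algebra.
From mathcomp Require Import all_classical reals.
From mathcomp Require Import finmap ssrZ.

Set Implicit Arguments.
Unset Strict Implicit.
Unset Printing Implicit Defensive.

Import Order.TTheory GRing.Theory Num.Theory.
Local Open Scope classical_set_scope.
Local Open Scope card_scope.
Local Open Scope ring_scope.

(** * Eigenvectors of principal submatrices and regular production *)

Lemma char_poly_trmx (R : comNzRingType) n (A : 'M[R]_n) :
  char_poly A^T = char_poly A.
Proof.
rewrite /char_poly -det_tr; congr (\det _).
by apply/matrixP => i j; rewrite !mxE eq_sym.
Qed.

Lemma subblock_mulE (R : realType) n (A : 'M[R]_n) (I J : {set 'I_n})
    (v : 'I_n -> R) (i : 'I_#|I|) :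
  (subblock A I J *m \col_j v (enum_val j)) i 0 =
    \sum_(j in J) A (enum_val i) j * v j.
Proof.
by rewrite mxE [RHS]big_enum_val; apply: eq_bigr => j _; rewrite !mxE.
Qed.

Lemma root_char_poly_principal_submx (R : realType) n (A : 'M[R]_n)
    (J : {set 'I_n}) (lambda : R) (v : 'I_n -> R) :
  (exists2 j, j \in J & v j != 0) ->
  (forall i, i \in J -> \sum_(j in J) A i j * v j = lambda * v i) ->
  root (char_poly (principal_submx A J)) lambda.
Proof.
(* [eigenvalue] concerns row vectors, so the transpose turns the column eigenvector [v] into a row
   one. *)
move=> [j jJ vj] Av; rewrite -char_poly_trmx -eigenvalue_root_char.
apply/eigenvalueP; exists (\row_k v (enum_val k)).
  apply/rowP => i; rewrite -[in LHS](trmxK (\row_k _)) -trmx_mul mxE.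
  have -> : (\row_k v (enum_val k))^T = \col_(k < #|J|) v (enum_val k).
    by apply/colP => k; rewrite !mxE.
  by rewrite /principal_submx subblock_mulE Av ?enum_valP // !mxE.
apply: contraNneq vj => /rowP/(_ (enum_rank_in jJ j)).
by rewrite !mxE enum_rankK_in // => ->.
Qed.

(** A monic polynomial of degree k with k distinct roots is the product of their linear factors, so
    every multiplicity is one and no root is missing. *)
Lemma simple_eigenvalue_uniq_roots (R : realType) k (B : 'M[R]_k) (s : seq R) :
  uniq s -> size s = k -> {in s, forall x, root (char_poly B) x} ->
  forall x, (simple_eigenvalue B x <-> x \in s) /\
            (root (char_poly B) x -> x \in s).
Proof.
move=> Us szs roots x.
have pE : char_poly B = \prod_(z <- s) ('X - z%:P).
  rewrite [LHS](@all_roots_prod_XsubC _ _ s).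
  - by rewrite (monicP (char_poly_monic B)) scale1r.
  - by rewrite size_char_poly szs.
  - exact/allP.
  - by rewrite uniq_rootsE.
rewrite /simple_eigenvalue pE mu_prod_XsubC root_prod_XsubC; split=> //.
by rewrite count_uniq_mem //; case: (x \in s).
Qed.

(** Trades vectors over ['I_#|J|] for functions on ['I_n], so that the linear conditions become sums
    over [J] free of enumerations. *)
Lemma regularly_producesP (R : realType) n (A : 'M[R]_n) (J : {set 'I_n})
    (lambda : R) :
  regularly_produces A J lambda <->
  simple_eigenvalue (principal_submx A J) lambda /\
  exists v : 'I_n -> R,
    [/\ forall i, i \in J -> 0 < v i,
        forall i, i \in J -> \sum_(j in J) A i j * v j = lambda * v i &
        forall i, i \notin J -> 0 < \sum_(j in J) A i j * v j].
Proof.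
split=> -[simpl]; last first.
  case=> v [v_gt0 Av Av_gt0]; split=> //; exists (\col_j v (enum_val j)).
  split=> [j||i].
  - by rewrite mxE v_gt0 ?enum_valP.
  - apply/colP => i; rewrite /principal_submx subblock_mulE Av ?enum_valP //.
    by rewrite !mxE.
  - by rewrite subblock_mulE Av_gt0 //; have := enum_valP i; rewrite inE.
case=> u [u_gt0 Au Au_gt0]; split=> //.
(* For empty [J] there is no [j0] to invert the enumeration with; any index off [J] would then make
   an empty sum positive. *)
have [J0|[j0 j0J]] := set_0Vmem J.
  exists (fun=> 0); split=> [i|i|i iJ]; rewrite ?J0 ?inE //.
  have iJ' : i \in finset.setC J by rewrite inE.
  have := Au_gt0 (enum_rank_in iJ' i); rewrite mxE big1 ?ltxx // => k _.
  by have := enum_valP k; rewrite {2}J0 inE.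
pose v i := u (enum_rank_in j0J i) 0; exists v.
have uE : u = \col_j v (enum_val j).
  by apply/colP => j; rewrite mxE /v enum_valK_in.
move: Au Au_gt0; rewrite uE => Au Au_gt0; split=> [i iJ|i iJ|i iJ].
- exact: u_gt0.
- move/colP/(_ (enum_rank_in j0J i)) : Au.
  by rewrite /principal_submx subblock_mulE !mxE enum_rankK_in.
- have iJ' : i \in finset.setC J by rewrite inE.
  by have := Au_gt0 (enum_rank_in iJ' i); rewrite subblock_mulE enum_rankK_in.
Qed.

(** Extend the eigenvector by 0 off [J]. Complementarity holds because the residual vanishes on [J]
    and the vector off [J]. *)
Lemma regular_pareto_eigenvalue (R : realType) n (A : 'M[R]_n) :
  regular_pareto_spectrum A `<=` pareto_spectrum A.
Proof.
move=> lambda [J [J0 /regularly_producesP[_ [v [v_gt0 Av Av_gt0]]]]].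
have [j jJ] := set0Pn _ J0.
pose x : 'cV[R]_n := \col_i (if i \in J then v i else 0).
have subE i : (A *m x - lambda *: x) i 0 =
    \sum_(j in J) A i j * v j - lambda * x i 0.
  transitivity ((A *m x) i 0 - lambda * x i 0); first by rewrite !mxE.
  rewrite mxE [in RHS]big_mkcond; congr (_ - _); apply: eq_bigr => k _; rewrite mxE.
  by case: ifP => // _; rewrite mulr0.
exists x; split.
- apply: contraTneq (v_gt0 j jJ) => /colP/(_ j); rewrite !mxE jJ => ->.
  by rewrite ltxx.
- by move=> i; rewrite mxE; case: ifP => // /v_gt0/ltW.
- move=> i; rewrite subE mxE.
  case: ifP => iJ; first by rewrite Av // subrr.
  by rewrite mulr0 subr0 ltW // Av_gt0 ?iJ.
- apply: big1 => i _; rewrite subE mxE.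
  by case: ifP => iJ; rewrite ?mul0r // Av // subrr mulr0.
Qed.

(** * Finiteness of the spectra and existence of the maxima *)

Lemma card_le_roots (R : realType) (p : {poly R}) (B : set R) :
  p != 0 -> (forall x, B x -> root p x) -> B #<= `I_(size p).
Proof.
move=> p0 rootB.
have fsetB (X : {fset R}) : [set` X] `<=` B -> (#|` X| < size p)%N.
  move=> XB; apply: max_poly_roots => //; last exact: fset_uniq.
  by apply/allP => x /XB/rootB.
have finB : finite_set B.
  apply: contrapT => /(infinite_set_fset (size p))[X /fsetB].
  by rewrite ltnNge => /negbTE ->.
have /card_eq_fsetP := erefl #|` fset_set B|.
rewrite fset_setK // => /card_le_eql ->.
by rewrite card_le_II ltnW // fsetB // fset_setK.
Qed.

(** Complementarity is a vanishing sum of nonnegative terms, so each term is 0 and A x = lambda x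
    holds on the support of [x]. *)
Lemma pareto_eigenvalue_root (R : realType) n (A : 'M[R]_n) (lambda : R) :
  pareto_eigenvalue A lambda ->
  exists J, root (char_poly (principal_submx A J)) lambda.
Proof.
move=> [x [x0 x_ge0 Ax_ge0 /psumr_eq0P compl]].
exists [set i | x i 0 != 0]%SET.
apply: (@root_char_poly_principal_submx _ _ _ _ _ (x ^~ 0)).
  have /matrix0Pn[i [j]] := x0; rewrite ord1 => xi0.
  by exists i; rewrite ?inE.
move=> i; rewrite inE => xi0.
have /eqP := compl (fun i _ => mulr_ge0 (x_ge0 i) (Ax_ge0 i)) i isT.
rewrite mulf_eq0 (negbTE xi0) /= !mxE subr_eq0 => /eqP <-.
rewrite big_mkcond; apply: eq_bigr => j _; rewrite inE.
by case: eqP => //= ->; rewrite mulr0.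
Qed.

Lemma pareto_spectrum_card_le (R : realType) n :
  exists N, forall A : 'M[R]_n, pareto_spectrum A #<= `I_N.
Proof.
(* This is the size of the product [p] below, as given by [size_prod]; it depends on [n] only. *)
exists ((\sum_(J : {set 'I_n}) #|J|.+1).+1 - #|{set 'I_n}|)%N => A.
pose p := \prod_(J : {set 'I_n}) char_poly (principal_submx A J).
have char_neq0 (J : {set 'I_n}) : char_poly (principal_submx A J) != 0.
  exact/monic_neq0/char_poly_monic.
have -> : ((\sum_(J : {set 'I_n}) #|J|.+1).+1 - #|{set 'I_n}|)%N = size p.
  rewrite size_prod //; congr (_.+1 - _)%N.
  by apply: eq_bigr => J _; rewrite size_char_poly.
apply: card_le_roots; first exact/prodf_neq0.
move=> lambda /pareto_eigenvalue_root[J rootJ].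
by rewrite /p (bigD1 J) //= rootM rootJ.
Qed.

(** Since [max_card] falls back to 0 without a maximum, the uniform bound [N] first yields a largest
    attained cardinality. *)
Lemma leq_max_card (R : realType) n (F : 'M[R]_n -> set R) (N m : nat)
    (A : 'M[R]_n) :
  (forall A, F A #<= `I_N) -> `I_m #<= F A -> (m <= Defs.max_card F)%N.
Proof.
move=> leN mA.
pose P k := `[< exists A, F A #= `I_k >].
have FA_fin B : exists k, F B #= `I_k.
  by apply/finite_setP/finite_set_leP; exists N.
have exP : exists k, P k by have [k Ak] := FA_fin A; exists k; apply/asboolP; exists A.
have leP k : P k -> (k <= N)%N.
  by move=> /asboolP[B Bk]; rewrite -card_le_II -(card_le_eql Bk) leN.
have [k /asboolP kF maxk] := ex_maxnP exP leP.
have : is_max_card F (Defs.max_card F).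
  apply: (xgetPex 0%N); exists k; split=> // B.
  have [l Bl] := FA_fin B.
  by rewrite (card_le_eql Bl) card_le_II maxk //; apply/asboolP; exists B.
case=> _ /(_ A) AM; rewrite -card_le_II.
exact: card_le_trans mA AM.
Qed.

(** * Integer polynomials and interval evaluation *)

(** Binary integers let [vm_compute] run the checks; this ring morphism carries the results to the
    reals. *)
Definition ofZ (R : pzRingType) (z : Z) : R := (int_of_Z z)%:~R.

HB.instance Definition _ (R : pzRingType) :=
  GRing.RMorphism.copy (ofZ R) (intr \o int_of_Z).

Lemma int_of_Z_ge0 (z : Z) : (0 <= int_of_Z z) = (0 <= z).
Proof. by case: z. Qed.

Lemma ofZ_le (R : numDomainType) (a b : Z) : (ofZ R a <= ofZ R b) = (a <= b).
Proof. by rewrite -subr_ge0 -rmorphB /= ler0z int_of_Z_ge0 subr_ge0. Qed.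

Lemma ofZ_lt (R : numDomainType) (a b : Z) : (ofZ R a < ofZ R b) = (a < b).
Proof. by rewrite !lt_neqAle ofZ_le !eq_le !ofZ_le. Qed.

Fixpoint heval (R : pzRingType) (p : seq Z) (x : R) : R :=
  if p is a :: p' then ofZ R a + x * heval p' x else 0.

Fixpoint padd (p q : seq Z) : seq Z :=
  match p, q with
  | a :: p', b :: q' => (a + b) :: padd p' q'
  | [::], _ => q
  | _, [::] => p
  end.

Definition pscale (a : Z) (p : seq Z) : seq Z := [seq a * b | b <- p].

Definition psum (ps : seq (seq Z)) : seq Z := foldr padd [::] ps.

Lemma heval_padd (R : comPzRingType) (p q : seq Z) (x : R) :
  heval (padd p q) x = heval p x + heval q x.
Proof.
elim: p q => [|a p IHp] [|b q] /=; rewrite ?add0r ?addr0 //.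
by rewrite IHp rmorphD mulrDr addrACA.
Qed.

Lemma heval_pscale (R : comPzRingType) (a : Z) (p : seq Z) (x : R) :
  heval (pscale a p) x = ofZ R a * heval p x.
Proof.
elim: p => [|b p IHp] /=; first by rewrite mulr0.
by rewrite IHp rmorphM mulrDr mulrCA.
Qed.

Lemma heval_psum (R : comPzRingType) (I : Type) (s : seq I) (F : I -> seq Z)
    (x : R) :
  heval (psum [seq F i | i <- s]) x = \sum_(i <- s) heval (F i) x.
Proof.
elim: s => [|i s IHs] /=; first by rewrite big_nil.
by rewrite heval_padd IHs big_cons.
Qed.

Lemma heval_all0 (R : pzRingType) (p : seq Z) (x : R) :
  all (eq_op^~ 0) p -> heval p x = 0.
Proof.
elim: p => //= a p IHp /andP[/eqP -> /IHp ->].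
by rewrite rmorph0 mulr0 addr0.
Qed.

Fixpoint zeval (p : seq Z) (m : Z) : Z :=
  if p is a :: p' then a + m * zeval p' m else 0.

Lemma heval_ofZ (R : pzRingType) (p : seq Z) (m : Z) :
  heval p (ofZ R m) = ofZ R (zeval p m).
Proof.
by elim: p => [|a p IHp] /=; rewrite ?rmorph0 // IHp rmorphD rmorphM.
Qed.

(* A lower bound by interval Horner evaluation on [m, m + 1], for m >= 0. *)
Fixpoint lower_bound (p : seq Z) (m : Z) : Z :=
  if p is a :: p' then
    let l := lower_bound p' m in a + Order.min (m * l) ((m + 1) * l)
  else 0.

Definition in_cell (R : numDomainType) (m : Z) (x : R) : bool :=
  ofZ R m <= x <= ofZ R (m + 1).

(** As x >= 0, a lower bound [l] of the tail bounds the product below by x l, which is linear in x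
    and so at least its smaller endpoint value. *)
Lemma lower_boundP (R : realDomainType) (p : seq Z) (m : Z) (x : R) :
  0 <= m -> in_cell m x -> ofZ R (lower_bound p m) <= heval p x.
Proof.
move=> m_ge0 /andP[mx xm]; elim: p => [|a p /= IHp]; first by rewrite rmorph0.
have x_ge0 : 0 <= x by apply: le_trans mx; rewrite -[0](rmorph0 (ofZ R)) ofZ_le.
rewrite rmorphD lerD2l; apply: le_trans (ler_wpM2l x_ge0 IHp).
set l := lower_bound p m.
have [l_ge0|l_lt0] := leP 0 l.
  apply: (@le_trans _ _ (ofZ R (m * l))); first by rewrite ofZ_le ge_min lexx.
  by rewrite rmorphM ler_wpM2r // -[0](rmorph0 (ofZ R)) ofZ_le.
apply: (@le_trans _ _ (ofZ R ((m + 1) * l))).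
  by rewrite ofZ_le ge_min lexx orbT.
by rewrite rmorphM ler_wnM2r // -[0](rmorph0 (ofZ R)) ofZ_le ltW.
Qed.

Lemma heval_gt0 (R : realDomainType) (p : seq Z) (m : Z) (x : R) :
  0 <= m -> in_cell m x -> 0 < lower_bound p m -> 0 < heval p x.
Proof.
move=> m_ge0 mx; rewrite -(ofZ_lt R) rmorph0 => /lt_le_trans; apply.
exact: lower_boundP.
Qed.

Lemma heval_ivt (R : rcfType) (p : seq Z) (m : Z) :
  zeval p m * zeval p (m + 1) <= 0 ->
  exists2 x : R, in_cell m x & heval p x = 0.
Proof.
pose P := Poly [seq ofZ R a | a <- p].
have PE x : P.[x] = heval p x.
  by rewrite horner_Poly; elim: p {P} => //= a p ->; rewrite addrC mulrC.
have le_mm : ofZ R m <= ofZ R (m + 1) by rewrite ofZ_le lerDl ler01.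
pose a := zeval p m; pose b := zeval p (m + 1).
have ivt (Q : {poly R}) : Q.[ofZ R m] <= 0 <= Q.[ofZ R (m + 1)] ->
    exists2 x, in_cell m x & root Q x.
  by move=> /poly_ivt[] // x mx rx; exists x.
rewrite -/a -/b; have [a_le0|a_gt0] := leP a 0 => ab.
  have [b_ge0|b_lt0] := leP 0 b.
    have [|x mx] := ivt P.
      by rewrite !PE !heval_ofZ -[0](rmorph0 (ofZ R)) !ofZ_le a_le0.
    by rewrite rootE PE => /eqP; exists x.
  (* Here b < 0, so a b <= 0 forces a >= 0, hence a = 0: the left endpoint is the root. *)
  have /eqP a0 : a == 0 by rewrite eq_le a_le0 -(nmulr_lle0 _ b_lt0).
  exists (ofZ R m); first by rewrite /in_cell lexx.
  by rewrite heval_ofZ -/a a0 rmorph0.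
have b_le0 : b <= 0 by rewrite -(pmulr_rle0 _ a_gt0).
have [|x mx] := ivt (- P).
  rewrite !hornerN !PE !heval_ofZ oppr_le0 oppr_ge0.
  by rewrite -[0](rmorph0 (ofZ R)) !ofZ_le b_le0 ltW.
by rewrite rootN rootE PE => /eqP; exists x.
Qed.

(* A certificate for a principal submatrix: the integer [m] in a cell stands for
   an eigenvalue in [m, m + 1]. A spurious cell, whose eigenvalue is not
   regularly produced, carries a Farkas vector excluding a positive eigenvector
   that is positive off the support. *)
Record certificate := Certificate {
  support : seq nat;
  charp : seq Z;
  regular_cells : seq Z;
  spurious_cells : seq (Z * seq Z)
}.

Definition zsum (s : seq Z) : Z := foldr +%R 0 s.

Lemma ofZ_zsum (R : pzRingType) (I : Type) (s : seq I) (F : I -> Z) :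
  ofZ R (zsum [seq F i | i <- s]) = \sum_(i <- s) ofZ R (F i).
Proof. by rewrite /zsum foldrE big_map rmorph_sum. Qed.

(** Cells are closed, so adjacent ones could share a root at their common endpoint; the strict
    inequalities rule this out. *)
Definition disjoint_cells (m m' : Z) : bool := (m + 1 < m') || (m' + 1 < m).

(** * The certificate checker *)

Section Checker.

Variables (n : nat) (M : nat -> nat -> Z) (c : certificate).
Let s := support c.
Let cells := regular_cells c ++ unzip1 (spurious_cells c).

(* Faddeev-LeVerrier recursion for the last column of adj (x - A_J), entrywise
   polynomials in x. Nothing is proved about it: [residual] checks that it is an
   eigenvector at each root of the characteristic polynomial. *)
Definition adj_step (V : seq (seq Z)) (a : Z) : seq (seq Z) :=
  mkseq (fun i => (zsum [seq M i j * head 0 (nth [::] V j) | j <- s] +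
                   (if i == last 0%N s then a else 0)) :: nth [::] V i) n.

Definition adj_col : seq (seq Z) :=
  foldl adj_step (mkseq (fun i => [:: if i == last 0%N s then 1 else 0]) n)
    (behead (rev (behead (charp c)))).

Definition mulr_col (V : seq (seq Z)) (i : nat) : seq Z :=
  psum [seq pscale (M i j) (nth [::] V j) | j <- s].

(** Encodes (M - x) V + p(x) e with e the last unit vector. It vanishes on the support for the last
    adjugate column, by (x - M_J) adj (x - M_J) = p(x) I. *)
Definition residual (V : seq (seq Z)) (i : nat) : seq Z :=
  padd (mulr_col V i) (padd (pscale (- 1) (0 :: nth [::] V i))
                            (if i == last 0%N s then charp c else [::])).

(** The adjugate column may be a negative multiple of the positive eigenvector; [e] is the
    correcting sign. *)
Definition positive_on (V : seq (seq Z)) (m e : Z) : bool :=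
  all (fun i => 0 < lower_bound
         (pscale e (if i \in s then nth [::] V i else mulr_col V i)) m)
      (iota 0 n).

(** [charp c] is never compared with the true characteristic polynomial: a root of it counts as an
    eigenvalue because the column there is a nonzero eigenvector. *)
Definition nonzero_on (V : seq (seq Z)) (m e : Z) : bool :=
  has (fun i => 0 < lower_bound (pscale e (nth [::] V i)) m) s.

(* Writing A_J for the rows in the support and B for the others, a positive
   solution u of (A_J - x) u = 0, B u > 0 is impossible if y >= 0 off the support
   and all entries of y^T (A - x) on the support are negative. *)
Definition farkas (m : Z) (y : seq Z) : bool :=
  all (fun i => (i \in s) || (0 <= nth 0 y i)) (iota 0 n) &&
  all (fun j => 0 < lower_bound
         [:: - zsum [seq nth 0 y i * M i j | i <- iota 0 n]; nth 0 y j] m) s.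

(** The first test makes the support an increasing list of indices below [n]; the next two make the
    cells account for the whole spectrum. *)
Definition certificate_ok : bool :=
  let V := adj_col in
  [&& [seq i <- iota 0 n | i \in s] == s,
      size cells == size s,
      pairwise disjoint_cells cells,
      all (fun m => (0 <= m) && (zeval (charp c) m * zeval (charp c) (m + 1) <= 0))
          cells,
      all (fun i => all (eq_op^~ 0) (residual V i)) s,
      all (fun m => has (positive_on V m) [:: 1; -1] && has (nonzero_on V m) [:: 1; -1])
        (regular_cells c) &
      all (fun my => has (nonzero_on V my.1) [:: 1; -1] && farkas my.1 my.2)
        (spurious_cells c)].

End Checker.

(** * Soundness of the checker *)

Definition support_set (n : nat) (s : seq nat) : {set 'I_n} :=
  [set i : 'I_n | (i : nat) \in s]%SET.

Lemma val_enum_support_set (n : nat) (s : seq nat) :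
  [seq i <- iota 0 n | i \in s] = s -> map val (enum (support_set n s)) = s.
Proof.
rewrite -{1}val_enum_ord filter_map => {2}<-; congr map.
by rewrite enumT; apply: eq_filter => i; rewrite !inE.
Qed.

(** Used to choose one root per cell while keeping the cell attached to it. *)
Lemma ex_zip (T U : eqType) (s : seq T) (P : U -> T -> Prop) :
  {in s, forall t, exists u, P u t} ->
  exists us : seq (U * T), map snd us = s /\ {in us, forall ut, P ut.1 ut.2}.
Proof.
elim: s => [|t s IHs] Ps; first by exists [::].
have [|us [<- Pus]] := IHs; first by move=> t' st'; apply/Ps/mem_behead.
have [u Put] := Ps t (mem_head _ _).
by exists ((u, t) :: us); split=> // ut; rewrite inE => /predU1P[->|/Pus].
Qed.

Lemma uniq_in_cells (R : realDomainType) (us : seq (R * Z)) :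
  pairwise disjoint_cells (map snd us) ->
  {in us, forall ut, in_cell ut.2 ut.1} -> uniq (map fst us).
Proof.
rewrite uniq_pairwise !pairwise_map => disj us_in.
apply: (@sub_in_pairwise _ (mem us)) disj; last exact/allP.
move=> u v uP vP /orP[]; rewrite -(ofZ_lt R) => lt_uv; apply/eqP => uv.
  have /andP[_ u_le] := us_in u uP; have /andP[v_ge _] := us_in v vP.
  by have := lt_le_trans lt_uv v_ge; rewrite -uv ltNge u_le.
have /andP[_ v_le] := us_in v vP; have /andP[u_ge _] := us_in u uP.
by have := lt_le_trans lt_uv u_ge; rewrite uv ltNge v_le.
Qed.

Section CertificateSoundness.

Variables (R : realType) (n : nat) (A : 'M[R]_n) (M : nat -> nat -> Z) (d : R).
Hypotheses (d_gt0 : 0 < d) (AM : forall i j : 'I_n, ofZ R (M i j) = d * A i j).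
Variable c : certificate.
Hypothesis c_ok : certificate_ok n M c.

Local Notation s := (support c).
Local Notation J := (support_set n s).
Local Notation V := (adj_col n M c).

Lemma mem_support_set (i : 'I_n) : (i \in J) = ((i : nat) \in s).
Proof. by rewrite inE. Qed.

Lemma sum_support (F : nat -> R) : \sum_(j <- s) F j = \sum_(j in J) F j.
Proof.
have /and5P[/eqP/val_enum_support_set hs _ _ _ _] := c_ok.
by rewrite -[X in \sum_(j <- X) _]hs big_map big_enum.
Qed.

Lemma heval_mulr_col (i : 'I_n) (x : R) :
  heval (mulr_col M c V i) x =
    d * \sum_(j in J) A i j * heval (nth [::] V j) x.
Proof.
rewrite heval_psum sum_support mulr_sumr; apply: eq_bigr => j _.
by rewrite heval_pscale AM mulrA.
Qed.

Lemma adj_col_eigenvector (lambda : R) :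
  heval (charp c) (d * lambda) = 0 ->
  forall i, i \in J ->
    \sum_(j in J) A i j * heval (nth [::] V j) (d * lambda) =
      lambda * heval (nth [::] V i) (d * lambda).
Proof.
move=> p0 i; rewrite mem_support_set => iJ.
have /and5P[_ _ _ _ /and3P[/allP/(_ i iJ) res _ _]] := c_ok.
have := heval_all0 (d * lambda) res; rewrite heval_padd heval_padd.
rewrite heval_mulr_col heval_pscale rmorphN1 mulN1r /= rmorph0 add0r.
(* The p(x) e term vanishes at a root, whether or not [i] is the last index. *)
rewrite (_ : heval (if _ then _ else _) _ = 0) ?addr0; last by case: ifP.
move/eqP; rewrite subr_eq0 -mulrA => /eqP; apply: mulfI.
by rewrite gt_eqF.
Qed.

Lemma nonzero_onP (m e : Z) (lambda : R) :
  0 <= m -> in_cell m (d * lambda) -> nonzero_on c V m e ->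
  exists2 j : 'I_n, j \in J & heval (nth [::] V j) (d * lambda) != 0.
Proof.
move=> m_ge0 mx /hasP[j js] /(heval_gt0 m_ge0 mx).
rewrite heval_pscale => Vj_gt0.
have j_lt : (j < n)%N.
  have /andP[/eqP hs _] := c_ok; move: js; rewrite -hs mem_filter mem_iota.
  by case/andP.
exists (Ordinal j_lt); first by rewrite mem_support_set.
by apply: contraTneq Vj_gt0 => ->; rewrite mulr0 ltxx.
Qed.

(** Compute y^T (lambda - A) u twice, with [u] extended by 0. By columns it is positive, strictly
    since [J] is nonempty. By rows, those in [J] cancel and the others contribute -y_i (A u)_i <=
    0. *)
Lemma farkas_infeasible (m : Z) (y : seq Z) (lambda : R) (u : 'I_n -> R) :
  0 <= m -> in_cell m (d * lambda) -> farkas n M c m y -> J != finset.set0 ->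
  (forall i, i \in J -> 0 < u i) ->
  (forall i, i \in J -> \sum_(j in J) A i j * u j = lambda * u i) ->
  (forall i, i \notin J -> 0 < \sum_(j in J) A i j * u j) -> False.
Proof.
move=> m_ge0 mx /andP[/allP y_ge0 /allP z_gt0] /set0Pn[j0 j0J] u_gt0 Au Au_gt0.
pose y' (i : 'I_n) : R := ofZ R (nth 0 y i).
have zE (j : 'I_n) : heval [:: - zsum [seq nth 0 y i * M i j | i <- iota 0 n];
    nth 0 y j] (d * lambda) = d * (lambda * y' j - \sum_i y' i * A i j).
  rewrite /= mulr0 addr0 rmorphN /= ofZ_zsum -/(y' j) mulrBr mulrA addrC.
  congr (_ - _); rewrite mulr_sumr -[iota 0 n]val_enum_ord big_map.
  rewrite enumT; apply: eq_bigr => i _.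
  by rewrite rmorphM /= AM -/(y' i) mulrCA.
have sum_gt0 : 0 < \sum_(j in J) (lambda * y' j - \sum_i y' i * A i j) * u j.
  have term_gt0 (j : 'I_n) : j \in J ->
      0 < (lambda * y' j - \sum_i y' i * A i j) * u j.
    move=> jJ; rewrite mulr_gt0 ?u_gt0 // -(pmulr_rgt0 _ d_gt0) -zE.
    by apply: heval_gt0 mx _ => //; apply: z_gt0; rewrite -mem_support_set.
  rewrite (bigD1 j0) //= ltr_wpDr ?term_gt0 // sumr_ge0 // => j /andP[jJ _].
  exact/ltW/term_gt0.
suff : \sum_(j in J) (lambda * y' j - \sum_i y' i * A i j) * u j <= 0.
  by rewrite leNgt sum_gt0.
under eq_bigr do rewrite mulrBl mulr_suml.
rewrite sumrB exchange_big /= [X in _ - X](bigID (mem J)) /=.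
have -> : \sum_(i in J) \sum_(j in J) y' i * A i j * u j =
    \sum_(i in J) lambda * y' i * u i.
  apply: eq_bigr => i iJ; under eq_bigr do rewrite -mulrA.
  by rewrite -mulr_sumr Au // mulrCA mulrA.
rewrite opprD addrA subrr sub0r oppr_le0 sumr_ge0 // => i iJ.
under eq_bigr do rewrite -mulrA.
rewrite -mulr_sumr mulr_ge0 ?(ltW (Au_gt0 _ iJ)) // /y'.
rewrite -[0](rmorph0 (ofZ R)) ofZ_le.
have i_n : (i : nat) \in iota 0 n by rewrite mem_iota /=.
by have /orP[i_s|//] := y_ge0 _ i_n; rewrite mem_support_set i_s in iJ.
Qed.

Lemma certificate_sound :
  exists us : seq (R * Z),
    [/\ map snd us = regular_cells c,
        {in us, forall ut, in_cell ut.2 (d * ut.1)} &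
        forall lambda, regularly_produces A J lambda <-> lambda \in map fst us].
Proof.
have := c_ok => /andP[/eqP hs /and5P[/eqP size_cells disj /allP bracket _]].
move=> /andP[/allP reg_ok /allP spur_ok].
have root_ex m : m \in regular_cells c ++ unzip1 (spurious_cells c) ->
    exists lambda, in_cell m (d * lambda) /\ heval (charp c) (d * lambda) = 0.
  move=> /bracket/andP[_ /heval_ivt-/(_ R)[x mx px]].
  by exists (d^-1 * x); rewrite mulVKf ?gt_eqF.
have m_ge0 m : m \in regular_cells c ++ unzip1 (spurious_cells c) -> 0 <= m.
  by move=> /bracket/andP[].
have reg_cell m : m \in regular_cells c ->
    m \in regular_cells c ++ unzip1 (spurious_cells c).
  by rewrite mem_cat => ->.
have spur_cell my : my \in spurious_cells c ->
    my.1 \in regular_cells c ++ unzip1 (spurious_cells c).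
  by move=> my_in; rewrite mem_cat map_f ?orbT.
have [|us [usE us_root]] := @ex_zip _ R (regular_cells c) (fun lambda m =>
    in_cell m (d * lambda) /\ heval (charp c) (d * lambda) = 0).
  by move=> m /reg_cell/root_ex.
have [|ws [wsE ws_root]] := @ex_zip _ R (spurious_cells c) (fun lambda my =>
    in_cell my.1 (d * lambda) /\ heval (charp c) (d * lambda) = 0).
  by move=> my /spur_cell/root_ex.
have us_cell ut : ut \in us -> ut.2 \in regular_cells c.
  by rewrite -usE; apply: map_f.
have ws_cell ut : ut \in ws -> ut.2 \in spurious_cells c.
  by rewrite -wsE; apply: map_f.
exists us; split=> // [ut /us_root[]//|lambda].
(* The spurious roots are needed to reach the #|J| distinct ones that exhaust the spectrum. *)
pose roots := map fst us ++ map fst ws.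
have uniq_roots : uniq roots.
  (* Cells contain d lambda rather than lambda, so distinctness is shown after scaling and pulled
     back by injectivity. *)
  pose scaled := [seq (d * ut.1, ut.2) | ut <- us] ++
    [seq (d * ut.1, ut.2.1) | ut <- ws].
  suff : uniq (map fst scaled).
    have -> : map fst scaled = [seq d * x | x <- roots].
      by rewrite !map_cat -!map_comp.
    by rewrite map_inj_uniq //; apply/mulfI; rewrite gt_eqF.
  apply: uniq_in_cells.
    by move: disj; rewrite /unzip1 -usE -wsE map_cat -!map_comp.
  move=> ut; rewrite mem_cat => /orP[] /mapP[rt rt_in ->] /=.
    by have [] := us_root rt rt_in.
  by have [] := ws_root rt rt_in.
have size_roots : size roots = #|J|.
  rewrite size_cat !size_map cardE -(size_map val) val_enum_support_set //.
  by rewrite -size_cells -usE -wsE size_cat !size_map.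
have root_roots : {in roots, forall x, root (char_poly (principal_submx A J)) x}.
  move=> x x_in.
  have [m [e [m_in mx px Vm]]] : exists m e,
      [/\ m \in regular_cells c ++ unzip1 (spurious_cells c),
        in_cell m (d * x), heval (charp c) (d * x) = 0 & nonzero_on c V m e].
    move: x_in; rewrite mem_cat => /orP[] /mapP[ut ut_in ->].
      have [mx px] := us_root ut ut_in.
      have /andP[_ /hasP[e _ Ve]] := reg_ok _ (us_cell _ ut_in).
      by exists ut.2, e; split=> //; apply/reg_cell/us_cell.
    have [mx px] := ws_root ut ut_in.
    have /andP[/hasP[e _ Ve] _] := spur_ok _ (ws_cell _ ut_in).
    by exists ut.2.1, e; split=> //; apply/spur_cell/ws_cell.
  apply: root_char_poly_principal_submx (adj_col_eigenvector px).
  exact: nonzero_onP (m_ge0 m m_in) mx Vm.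
have [simpleE in_roots] :=
  simple_eigenvalue_uniq_roots uniq_roots size_roots root_roots lambda.
rewrite regularly_producesP simpleE mem_cat; split.
  move=> [/orP[//|/mapP[ut ut_in lambdaE]] [v [v_gt0 Av Av_gt0]]].
  have /andP[_ Fy] := spur_ok _ (ws_cell _ ut_in).
  have [mx _] := ws_root ut ut_in; rewrite -lambdaE in mx.
  have m0 := m_ge0 _ (spur_cell _ (ws_cell _ ut_in)).
  have J0 : J != finset.set0.
    rewrite -card_gt0 -size_roots size_cat addn_gt0 orbC size_map.
    by case: (ws) ut_in.
  by case: (farkas_infeasible m0 mx Fy J0 v_gt0 Av Av_gt0).
move=> lambda_in; split; first by rewrite lambda_in.
have /mapP[ut ut_in lambdaE] := lambda_in.
have [] := us_root ut ut_in; rewrite -lambdaE => mx px.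
have m0 := m_ge0 _ (reg_cell _ (us_cell _ ut_in)).
have /andP[/hasP[e _ /allP pos] _] := reg_ok _ (us_cell _ ut_in).
have {}pos (i : 'I_n) : 0 < ofZ R e * heval
    (if i \in J then nth [::] V i else mulr_col M c V i) (d * lambda).
  rewrite -heval_pscale mem_support_set; apply: heval_gt0 mx _ => //.
  by apply: pos; rewrite mem_iota /=.
exists (fun i => ofZ R e * heval (nth [::] V i) (d * lambda)).
split=> i iJ.
- by have := pos i; rewrite iJ.
- under eq_bigr do rewrite mulrCA.
  by rewrite -mulr_sumr adj_col_eigenvector // mulrCA.
- under eq_bigr do rewrite mulrCA.
  have := pos i; rewrite (negbTE iJ) heval_mulr_col mulrCA pmulr_rgt0 //.
  by rewrite -mulr_sumr.
Qed.

End CertificateSoundness.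

Lemma certificates_sound (R : realType) n (A : 'M[R]_n) (M : nat -> nat -> Z)
    (d : R) (cs : seq certificate) :
  0 < d -> (forall i j : 'I_n, ofZ R (M i j) = d * A i j) ->
  all (certificate_ok n M) cs ->
  exists us : seq (R * Z),
    [/\ map snd us = flatten [seq regular_cells c | c <- cs],
        {in us, forall ut, in_cell ut.2 (d * ut.1)} &
        forall lambda, lambda \in map fst us <->
          exists2 s, s \in map support cs &
            regularly_produces A (support_set n s) lambda].
Proof.
move=> d_gt0 AM; elim: cs => [_|c cs IHcs /= /andP[c_ok /IHcs]].
  by exists [::]; split=> // lambda; split=> // -[].
move=> [us [usE us_cell usP]].
have [vs [vsE vs_cell vsP]] := certificate_sound d_gt0 AM c_ok.
exists (vs ++ us); split=> [||lambda].
- by rewrite map_cat vsE usE.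
- by move=> ut; rewrite mem_cat => /orP[/vs_cell|/us_cell].
- rewrite map_cat mem_cat; split.
    move=> /orP[/vsP reg|/usP[s s_cs reg]].
      by exists (support c); rewrite ?mem_head.
    by exists s; rewrite ?inE ?s_cs ?orbT.
  move=> [s]; rewrite inE => /predU1P[->|s_cs] reg.
    by apply/orP; left; apply/vsP.
  by apply/orP; right; apply/usP; exists s.
Qed.

Lemma card_set_uniq (T : choiceType) (s : seq T) :
  uniq s -> [set` s] #= `I_(size s).
Proof.
move=> s_uniq; have -> : [set` s] = [set` [fset x in s]%fset].
  by apply/seteqP; split=> x /=; rewrite inE.
by apply/card_eq_fsetP; rewrite card_fseq undup_id.
Qed.

Lemma support_set_enum n (J : {set 'I_n}) : support_set n (map val (enum J)) = J.
Proof. by apply/setP => i; rewrite inE mem_map ?mem_enum //; apply: val_inj. Qed.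

(* The certificates for [A_star] and the count *)
Delimit Scope Z_scope with coqZ.

Definition resolution : Z := 1000%coqZ.

Definition A_star_table : seq (seq Z) :=
  ([:: [:: 100; 106; -18; -81];
       [:: 92; 158; -24; -101];
       [:: 2; 44; 37; -7];
       [:: 21; 38; 0; 2]])%coqZ.

(* The eigenvalues of the matrix are multiplied by [resolution] so that unit
   cells separate them. *)
Definition scale_roots (d : Z) (p : seq Z) : seq Z :=
  mkseq (fun i => nth 0 p i * d ^+ ((size p).-1 - i)) (size p).

Definition Cert (s : seq nat) (p cells : seq Z)
    (spurious : seq (Z * seq Z)) : certificate :=
  Certificate s (scale_roots resolution p) cells spurious.

(** All 15 nonempty supports, with indices from 0. Cell 231922 stands for an eigenvalue in
    [231.922, 231.923]; an integer eigenvalue is the left end of its cell. *)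
Definition A_star_certificates : seq certificate := ([::
  Cert [:: 0%N] [:: -100; 1]
    [:: 100000] [::];
  Cert [:: 1%N] [:: -158; 1]
    [:: 158000] [::];
  Cert [:: 2%N] [:: -37; 1]
    [::] [:: (37000, [:: 1; 1; 0; 0])];
  Cert [:: 3%N] [:: -2; 1]
    [::] [:: (2000, [:: 1; 1; 1; 0])];
  Cert [:: 0%N; 1%N] [:: 6048; -258; 1]
    [:: 231922] [:: (26077, [:: -1; -1; 0; 0])];
  Cert [:: 0%N; 2%N] [:: 3736; -137; 1]
    [:: 37576; 99423] [::];
  Cert [:: 0%N; 3%N] [:: 1901; -102; 1]
    [:: 77457] [:: (24542, [:: -1; 1; 1; -1])];
  Cert [:: 1%N; 2%N] [:: 6902; -195; 1]
    [:: 46468; 148531] [::];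
  Cert [:: 1%N; 3%N] [:: 4154; -160; 1]
    [:: 32608; 127391] [::];
  Cert [:: 2%N; 3%N] [:: 74; -39; 1]
    [::] [:: (2000, [:: 1; 1; -1; -1]); (37000, [:: 1; 1; 0; -1])];
  Cert [:: 0%N; 1%N; 2%N] [:: -257112; 16686; -295; 1]
    [:: 41016; 226281] [:: (27702, [:: 1; -1; -1; 0])];
  Cert [:: 0%N; 1%N; 3%N] [:: -156652; 12103; -260; 1]
    [:: 26282; 29134; 204583] [::];
  Cert [:: 0%N; 2%N; 3%N] [:: -73055; 5711; -139; 1]
    [:: 28711; 32863; 77425] [::];
  Cert [:: 1%N; 2%N; 3%N] [:: -162194; 11130; -197; 1]
    [:: 66970; 107500] [:: (22529, [:: 0; 0; -1; 1])];
  Cert [:: 0%N; 1%N; 2%N; 3%N] [:: 6211648; -649013; 22815; -297; 1]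
    [:: 26414; 49143; 197173] [:: (24268, [:: -5; 5; -1; -4])]])%coqZ.

Definition A_star_scaled (i j : nat) : Z :=
  resolution * nth 0 (nth [::] A_star_table i) j.

Lemma A_star_certificates_ok :
  all (certificate_ok 4 A_star_scaled) A_star_certificates.
Proof. by vm_compute. Qed.

(** Separates eigenvalues across supports. The tightest pair is near 77.425 for {0, 2, 3} and 77.457
    for {0, 3}. *)
Lemma A_star_disjoint_cells :
  pairwise disjoint_cells (flatten [seq regular_cells c | c <- A_star_certificates]).
Proof. by vm_compute. Qed.

Lemma A_star_supports (J : {set 'I_4}) : J != finset.set0 ->
  map val (enum J) \in map support A_star_certificates.
Proof.
(* Written as a mask of 0, 1, 2, 3, the support is determined by four booleans, at least one of them
   true, which leaves finitely many cases to compute. *)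
have -> : map val (enum J) = mask [seq i \in J | i <- enum 'I_4] (iota 0 4).
  by rewrite -val_enum_ord -map_mask -filter_mask [in RHS]enumT.
case/set0Pn => i iJ.
have : true \in [seq i \in J | i <- enum 'I_4].
  by apply/mapP; exists i; rewrite ?mem_enum.
have : size [seq i \in J | i <- enum 'I_4] = 4%N by rewrite size_map size_enum_ord.
by case: (map _ _) => [|[] [|[] [|[] [|[] [|]]]]].
Qed.

Lemma A_star_supports_neq0 (s : seq nat) :
  s \in map support A_star_certificates -> support_set 4 s != finset.set0.
Proof.
move=> s_in; have /allP/(_ s s_in)/hasP[i i_s i_lt] :
    all (has (fun i => i < 4)%N) (map support A_star_certificates) by [].
by apply/set0Pn; exists (Ordinal i_lt); rewrite inE.
Qed.

Lemma A_star_scaledE (R : realType) (i j : 'I_4) :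
  ofZ R (A_star_scaled i j) = ofZ R resolution * A_star R i j.
Proof.
rewrite /A_star_scaled rmorphM; congr (_ * _); rewrite mxE.
by case: i => -[|[|[|[|//]]]] ?; case: j => -[|[|[|[|//]]]] ?.
Qed.

Lemma card_regular_pareto_spectrum_A_star (R : realType) :
  regular_pareto_spectrum (A_star R) #= `I_23.
Proof.
have d_gt0 : 0 < ofZ R resolution by rewrite -(rmorph0 (ofZ R)) ofZ_lt.
have [us [usE us_cell usP]] :=
  certificates_sound d_gt0 (@A_star_scaledE R) A_star_certificates_ok.
have -> : regular_pareto_spectrum (A_star R) = [set` map fst us].
  apply/seteqP; split=> lambda /=.
    move=> [J [/A_star_supports Js reg]]; apply/usP.
    by exists (map val (enum J)); rewrite // support_set_enum.
  move/usP => [s /A_star_supports_neq0 s0 reg].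
  by exists (support_set 4 s).
have -> : 23%N = size (map fst us) by rewrite size_map -(size_map snd) usE.
apply: card_set_uniq.
have : uniq (map fst [seq (ofZ R resolution * ut.1, ut.2) | ut <- us]).
  apply: uniq_in_cells.
    by rewrite -map_comp -/(map snd us) usE A_star_disjoint_cells.
  by move=> ut /mapP[rt rt_in ->]; exact: us_cell rt rt_in.
rewrite -map_comp (map_comp _ fst); apply: map_uniq.
Qed.

Theorem proposition2p9 (R : realType) :
  [/\ regular_pareto_spectrum (A_star R) #= `I_23,
      (23 <= pareto_max_reg R 4)%N &
      (23 <= pareto_max R 4)%N].
Proof.
have reg23 := card_regular_pareto_spectrum_A_star R.
have le23 : `I_23 #<= regular_pareto_spectrum (A_star R).
  by have /card_eqPle[] := reg23.
(* One bound serves both maxima, because regular Pareto eigenvalues are Pareto eigenvalues. *)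
have [N leN] := pareto_spectrum_card_le R 4.
split=> //.
- apply: leq_max_card le23 => A.
  exact: card_le_trans (subset_card_le (@regular_pareto_eigenvalue _ _ A)) (leN A).
- apply: leq_max_card leN _.
  exact: card_le_trans le23 (subset_card_le (@regular_pareto_eigenvalue _ _ _)).
Qed.
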